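(* Let $G=G[X,Y]$ be a bipartite graph on $n$ vertices with bipartition $(X,Y)$. Assume $|X|=r$, $|Y|=s$ and $r\leq s$. Then $$0\leq \kappa(G)+\kappa(G^{bc})\leq r$$ and $$0\leq \kappa(G)\,\kappa(G^{bc})\leq\left\lceil\frac{r}{2}\right\rceil\left\lfloor\frac{r}{2}\right\rfloor .$$ Furthermore, these bounds are best possible.
   Context: All graphs are finite and simple. $G=G[X,Y]$ denotes a bipartite graph with a specified bipartition $(X,Y)$: every edge joins a vertex of $X$ to a vertex of $Y$. Its bipartite complementary graph $G^{bc}$ is the bipartite graph with $V(G^{bc})=V(G)$, the same bipartition $(X,Y)$, and $E(G^{bc})=\{xy: x\in X,\ y\in Y,\ xy\notin E(G)\}$. The vertex-connectivity $\kappa(H)$ of a graph $H$ is the minimum size of a vertex set $S$ such that $H-S$ is disconnected or has only one vertex.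
   Formalization: ''Best possible'' is proved as attainment for every r ≤ s, except where it fails: the lower bound 0 on the sum is not attained for r = s = 1 (the sum is always 1), and the upper bound on the product is never attained for r = 2 or r = 3. *)

(* Defs.v *)
From mathcomp Require Import all_boot.

Set Implicit Arguments.
Unset Strict Implicit.
Unset Printing Implicit Defensive.

Record sgraph := SGraph {
  vertex :> finType;
  adj : rel vertex;
  adj_sym : symmetric adj;
  adj_irr : irreflexive adj }.

Record bigraph := BiGraph {
  bg_graph :> sgraph;
  partX : {set bg_graph};
  partY : {set bg_graph};
  partU : partX :|: partY = setT;
  partI : partX :&: partY = set0;
  bg_edge : forall u v : bg_graph, adj u v ->
    (u \in partX) && (v \in partY) || (u \in partY) && (v \in partX) }.

Section BipartiteComplement.
Variable G : bigraph.

Definition bc_adj : rel G := [rel u v |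
  ((u \in partX G) && (v \in partY G) || (u \in partY G) && (v \in partX G))
  && ~~ adj u v].

Lemma bc_adj_sym : symmetric bc_adj.
Proof.
by move=> u v; rewrite /bc_adj /= adj_sym orbC [in X in X || _]andbC
  [in X in _ || X]andbC.
Qed.

Lemma bc_adj_irr : irreflexive bc_adj.
Proof.
move=> u; rewrite /bc_adj /= [(u \in partY G) && _]andbC orbb -in_setI partI.
by rewrite in_set0.
Qed.

Lemma bc_adj_edge (u v : SGraph bc_adj_sym bc_adj_irr) : adj u v ->
  (u \in partX G) && (v \in partY G) || (u \in partY G) && (v \in partX G).
Proof. by case/andP. Qed.

Definition bip_compl : bigraph :=
  @BiGraph (SGraph bc_adj_sym bc_adj_irr) (partX G) (partY G)
    (partU G) (partI G) bc_adj_edge.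

End BipartiteComplement.

Section Connectivity.
Variable G : sgraph.
Implicit Type S : {set G}.

Definition del_adj S : rel G :=
  [rel u v | [&& u \notin S, v \notin S & adj u v]].

Definition del_disconnected S : bool :=
  [exists u in ~: S, exists v in ~: S, ~~ connect (del_adj S) u v].

Definition vertex_cut S : bool := del_disconnected S || (#|~: S| == 1).

(* For a nonempty graph the default value #|G| is never the minimum, since the
   complement of a singleton is a vertex_cut; the graph without vertices, which
   has no vertex_cut, gets connectivity 0. *)
Definition kappa : nat := \big[minn/#|G|]_(S : {set G} | vertex_cut S) #|S|.

Lemma kappa_le S : vertex_cut S -> kappa <= #|S|.
Proof.
rewrite /kappa => cutS.
have: S \in index_enum {set G} by rewrite mem_index_enum.
elim: (index_enum _) => // A s IHs; rewrite inE big_cons => /orP[/eqP <-|/IHs].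
  by rewrite cutS geq_minl.
by case: ifP => // _; apply: leq_trans (geq_minr _ _).
Qed.

Lemma kappa_attained : 0 < #|G| -> exists2 S, vertex_cut S & #|S| = kappa.
Proof.
case/card_gt0P => x _.
have cutx : vertex_cut (~: [set x]) by rewrite /vertex_cut setCK cards1 eqxx orbT.
have ltk : kappa < #|G|.
  apply: leq_ltn_trans (kappa_le cutx) _.
  by rewrite -[X in _ < X](cardsC [set x]) cards1 add1n.
have : kappa = #|G| \/ exists2 S, vertex_cut S & #|S| = kappa.
  rewrite /kappa; apply: (big_ind (fun k =>
    k = #|G| \/ exists2 S, vertex_cut S & #|S| = k)); first by left.
  - by move=> a b Ha Hb; case: (leqP a b) => _.
  - by move=> S cutS; right; exists S.
by case=> // kE; rewrite kE ltnn in ltk.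
Qed.

End Connectivity.

(* Main.v *)
Require Import Defs.
From mathcomp Require Import all_boot ssralg zmodp.
From mathcomp Require Import zify.

(** Every neighbourhood is a vertex cut, and the degrees of a vertex y of Y in G
    and in its bipartite complement add up to r; hence the upper bounds. The
    edgeless graph (whose complement is K_{r,s}) attains the sum bound. For the
    product bound, let X be Z_r and join x to y when x lies in the cyclic window
    of length k starting at f y, where f maps Y onto Z_r. The bipartite
    complement has the same shape with windows of length r - k, so it suffices
    that such a graph is k-connected when 1 < k <= r. If deleting t vertices of X
    separates the survivors into A and B, every y whose window meets both A and B
    must be deleted too, and there are at least k - t such windows: the set of
    their starting points grows with the window length until it is all of Z_r. *)

Set Implicit Arguments.
Unset Strict Implicit.
Unset Printing Implicit Defensive.

Import GRing.Theory.

(** * Upper bounds from neighbourhoods *)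

Lemma kappa_le_degree (G : sgraph) (v : G) : kappa G <= #|[set u | adj v u]|.
Proof.
apply: kappa_le; rewrite /vertex_cut orbC; case: eqP => //= ncard.
set N := [set u | adj v u] in ncard *.
have vN : v \in ~: N by rewrite !inE adj_irr.
have: #|~: N| != 1 by apply/eqP.
rewrite (cardsD1 v) vN add1n eqSS cards_eq0 => /set0Pn[w].
rewrite in_setD1 => /andP[neq_wv wN].
apply/existsP; exists v; rewrite vN; apply/existsP; exists w; rewrite wN /=.
apply/negP => /connectP[[|z p] /=].
  by move=> _ /eqP; rewrite (negPf neq_wv).
by rewrite /del_adj /= /N !inE; case: (adj v z); rewrite ?andbF.
Qed.

Lemma kappa_void (G : sgraph) : #|G| = 0 -> kappa G = 0.
Proof.
move=> G0; apply/eqP; rewrite -leqn0 /kappa G0.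
by elim/big_rec: _ => // S m _ m0; rewrite geq_min m0 orbT.
Qed.

Lemma kappa_ge (G : sgraph) k : 0 < #|G| ->
  (forall S : {set G}, #|S| < k -> ~~ vertex_cut S) -> k <= kappa G.
Proof.
move=> /kappa_attained[S cutS <-] ncut; rewrite leqNgt.
by apply/negP => /ncut; rewrite cutS.
Qed.

Lemma eq_kappa (V : finType) (e1 e2 : rel V) (sym1 : symmetric e1)
    (irr1 : irreflexive e1) (sym2 : symmetric e2) (irr2 : irreflexive e2) :
  e1 =2 e2 -> kappa (SGraph sym1 irr1) = kappa (SGraph sym2 irr2).
Proof.
move=> eq_e; apply: eq_bigl => S; rewrite /vertex_cut; congr (_ || _).
apply: eq_existsb => u; congr (_ && _); apply: eq_existsb => v.
congr (_ && ~~ _); apply: eq_connect => x y /=.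
by rewrite /del_adj /= eq_e.
Qed.

Lemma kappa_add_compl_le (G : bigraph) : #|partX G| <= #|partY G| ->
  kappa G + kappa (bip_compl G) <= #|partX G|.
Proof.
(* An empty Y forces X empty, and both connectivities are then 0. Otherwise some [y] in Y has
   disjoint neighbourhoods in the two graphs, both inside X. *)
move=> le_XY; have [Y0 | [y yY]] := set_0Vmem (partY G).
  have X0 : partX G = set0.
    by apply/eqP; rewrite -cards_eq0 -leqn0 (leq_trans le_XY) // Y0 cards0.
  have V0 : #|G| = 0 by rewrite -cardsT -partU X0 Y0 setU0 cards0.
  by rewrite !kappa_void.
have yX : y \notin partX G.
  by apply/negP => yX; move: (in_set0 y); rewrite -partI inE yX yY.
pose N := [set u | adj y u]; pose N' : {set G} := [set u | bc_adj y u].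
apply: (@leq_trans (#|N| + #|N'|)).
  exact: leq_add (kappa_le_degree y) (@kappa_le_degree (bip_compl G) y).
have -> : #|N| + #|N'| = #|N :|: N'|.
  rewrite -cardsUI (_ : N :&: N' = set0) ?cards0 ?addn0 //.
  by apply/setP => u; rewrite !inE /bc_adj /=; case: adj; rewrite ?andbF.
apply/subset_leq_card/subsetP => u.
rewrite !inE => /orP[/bg_edge|/andP[]]; rewrite (negPf yX) /= => /andP[] //.
Qed.

(** By AM-GM, 4ab <= r^2; for odd r = 2h + 1, integrality sharpens this to ab <= h(h + 1). *)
Lemma leq_mul_halves a b r : a + b <= r -> a * b <= uphalf r * r./2.
Proof.
move=> le_abr; have le4 : 4 * (a * b) <= r ^ 2.
  by apply: leq_trans (nat_AGM2 a b) _; rewrite leq_exp2r.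
have := uphalf_half r; have := odd_double_half r; move: le4.
rewrite -mul2n -mulnn; set h := r./2 => le4 rE ->.
by rewrite -{}rE in le4; case: (odd r) le4 => /=; nia.
Qed.

(** * Bipartite graphs given by a relation, and a criterion for k-connectivity *)

Section BipartiteFromRelation.
Variables (X Y : finType) (e : X -> Y -> bool).

Definition bip_adj : rel (X + Y) := fun u v =>
  match u, v with
  | inl x, inr y => e x y
  | inr y, inl x => e x y
  | _, _ => false
  end.

Lemma bip_adj_sym : symmetric bip_adj. Proof. by move=> [x|y] [x'|y']. Qed.
Lemma bip_adj_irr : irreflexive bip_adj. Proof. by move=> [x|y]. Qed.

Definition bipX : {set X + Y} := [set u | if u is inl _ then true else false].
Definition bipY : {set X + Y} := [set u | if u is inr _ then true else false].

Lemma bip_partU : bipX :|: bipY = setT.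
Proof. by apply/setP => -[x|y]; rewrite !inE. Qed.

Lemma bip_partI : bipX :&: bipY = set0.
Proof. by apply/setP => -[x|y]; rewrite !inE. Qed.

Lemma bip_edge u v : bip_adj u v ->
  (u \in bipX) && (v \in bipY) || (u \in bipY) && (v \in bipX).
Proof. by case: u v => [x|y] [x'|y']; rewrite !inE. Qed.

Definition bip : bigraph :=
  @BiGraph (SGraph bip_adj_sym bip_adj_irr) bipX bipY bip_partU bip_partI
    bip_edge.

Lemma card_sum_set (S : {set X + Y}) :
  #|S| = #|[set x | inl x \in S]| + #|[set y | inr y \in S]|.
Proof.
rewrite -!sum1_card big_sumType /=; congr (_ + _);
  by apply: eq_bigl => z; rewrite inE.
Qed.

Lemma card_bipX : #|partX bip| = #|X|.
Proof.
rewrite /= card_sum_set -[RHS]addn0; congr (_ + _).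
  by apply: eq_card => x; rewrite !inE.
by apply: eq_card0 => y; rewrite !inE.
Qed.

Lemma card_bipY : #|partY bip| = #|Y|.
Proof.
rewrite /= card_sum_set -[RHS]add0n; congr (_ + _).
  by apply: eq_card0 => x; rewrite !inE.
by apply: eq_card => y; rewrite !inE.
Qed.

Lemma kappa_bip_isolated (y : Y) : (forall x, ~~ e x y) -> kappa bip = 0.
Proof.
move=> iso; apply/eqP; rewrite -leqn0.
apply: leq_trans (@kappa_le_degree bip (inr y)) _.
rewrite leqn0 cards_eq0; apply/eqP/setP => -[x|y']; rewrite !inE //=.
exact: negPf.
Qed.

(* If deleting fewer than k vertices separates the survivors of X into A and B,
   every y adjacent to both A and B must have been deleted. *)
Lemma kappa_bip_ge k : 0 < #|Y| ->
  (forall y, k <= #|[set x | e x y]|) ->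
  (forall A B : {set X}, A != set0 -> B != set0 -> #|~: (A :|: B)| < k ->
     k <= #|~: (A :|: B)|
          + #|[set y | [exists x in A, e x y] && [exists x in B, e x y]]|) ->
  k <= kappa bip.
Proof.
move=> /card_gt0P[y0 _] deg_ge sep.
apply: kappa_ge => [|S ltSk]; first by apply/card_gt0P; exists (inr y0).
pose c := connect (@del_adj bip S).
have c_sym : connect_sym (@del_adj bip S).
  apply: sym_connect_sym => u v; rewrite /del_adj /= bip_adj_sym.
  by rewrite andbCA.
pose T := [set x | inl x \in S].
have cardS : #|S| = #|T| + #|[set y | inr y \in S]| by exact: card_sum_set.
(* At least k neighbours and fewer than k deletions: some neighbour survives. *)
have nbrP y : inr y \notin S -> exists2 x, inl x \notin S & c (inr y) (inl x).
  move=> yS; have /subsetPn[x] : ~~ ([set x | e x y] \subset T).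
    apply: contraL ltSk => /subset_leq_card leT; rewrite -leqNgt cardS.
    exact: leq_trans (leq_trans (deg_ge y) leT) (leq_addr _ _).
  rewrite !inE => exy xS; exists x => //; apply: connect1.
  by rewrite /del_adj /= yS xS.
have cX x x' : inl x \notin S -> inl x' \notin S -> c (inl x) (inl x').
  move=> xS x'S; apply: contraLR ltSk => ncx; rewrite -leqNgt.
  (* The survivors in X split into those reachable from [x] and the others, among them [x']. *)
  pose A := [set z | (inl z \notin S) && c (inl x) (inl z)].
  pose B := [set z | (inl z \notin S) && ~~ c (inl x) (inl z)].
  have TE : ~: (A :|: B) = T.
    by apply/setP => z; rewrite !inE -andb_orr orbN andbT negbK.
  case: (leqP k #|T|) => [leT|ltT].
    by rewrite cardS (leq_trans leT) ?leq_addr.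
  have := sep A B; rewrite TE cardS => /(_ _ _ ltT) sepAB.
  apply: leq_trans (sepAB _ _) _.
  - by apply/set0Pn; exists x; rewrite inE xS; exact: connect0.
  - by apply/set0Pn; exists x'; rewrite inE x'S.
  rewrite leq_add2l; apply/subset_leq_card/subsetP => y; rewrite !inE.
  case/andP=> /existsP[a /andP[]]; rewrite inE => /andP[aS ca] eay.
  case/existsP=> b /andP[]; rewrite inE => /andP[bS ncb] eby.
  apply: contraNT ncb => yS; apply: connect_trans ca _.
  apply: (@connect_trans _ _ (inr y)); apply: connect1;
    by rewrite /del_adj /= ?aS ?bS yS.
have toX u : u \notin S -> exists2 x, inl x \notin S & c u (inl x).
  by case: u => [x|y]; [exists x => //; exact: connect0 | exact: nbrP].
have c_all u v : u \notin S -> v \notin S -> c u v.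
  move=> /toX[x xS cux] /toX[x' x'S cvx'].
  apply: connect_trans cux _; apply: connect_trans (cX _ _ xS x'S) _.
  by rewrite c_sym.
rewrite negb_or; apply/andP; split.
  apply/existsP => -[u /andP[uS /existsP[v /andP[vS]]]].
  by rewrite -/(c u v) c_all // -in_setC.
(* At least two vertices survive: |X| >= k, |Y| >= 1 and |S| < k. *)
have leX : k <= #|X| by apply: leq_trans (deg_ge y0) (max_card _).
have gtY : 0 < #|Y| by apply/card_gt0P; exists y0.
by rewrite cardsCs setCK card_sum; lia.
Qed.

End BipartiteFromRelation.

Lemma kappa_bip_compl (X Y : finType) (e : X -> Y -> bool) :
  kappa (bip_compl (bip e)) = kappa (bip (fun x y => ~~ e x y)).
Proof.
by apply: eq_kappa => -[x|y] [x'|y']; rewrite /bc_adj /= !inE.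
Qed.

Lemma eq_kappa_bip (X Y : finType) (e e' : X -> Y -> bool) :
  e =2 e' -> kappa (bip e) = kappa (bip e').
Proof. by move=> eqe; apply: eq_kappa => -[x|y] [x'|y'] /=. Qed.

(** All of Y is adjacent to both sides of any separation, and |Y| >= |X|. *)
Lemma kappa_bip_complete (X Y : finType) (e : X -> Y -> bool) :
  0 < #|Y| -> #|X| <= #|Y| -> (forall x y, e x y) -> #|X| <= kappa (bip e).
Proof.
move=> Y0 leXY eT; apply: kappa_bip_ge => // [y|A B].
  by rewrite -cardsT; apply/subset_leq_card/subsetP => x; rewrite !inE eT.
move=> /set0Pn[a aA] /set0Pn[b bB] _.
apply: leq_trans leXY (leq_trans _ (leq_addl _ _)).
rewrite -cardsT; apply/subset_leq_card/subsetP => y _; rewrite inE.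
by apply/andP; split; apply/existsP;
  [exists a; rewrite aA eT | exists b; rewrite bB eT].
Qed.

(** * Cyclic windows in Z_r *)

Section CyclicWindows.
Variable n : nat.
Notation r := n.+2.
Implicit Types (A B C : {set 'I_r}) (j : 'I_r).

(** Since 1 generates Z_r, repeated subtraction of 1 leads from one element to every other. *)
Lemma shift_closed_setT C : C != set0 ->
  (forall j, (j + 1)%R \in C -> j \in C) -> C = setT.
Proof.
move=> /set0Pn[j jC] clC; apply/setP => i; rewrite inE.
have sub d : (j - d%:R)%R \in C.
  elim: d => [|d IHd]; first by rewrite subr0.
  by apply: clC; rewrite mulrSr opprD addrA subrK.
by rewrite -[i](subKr j) -[(j - i)%R]natr_Zp sub.
Qed.

Lemma shift_boundary C : C != set0 -> C != setT ->
  exists2 j, j \notin C & (j + 1)%R \in C.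
Proof.
move=> C0 CT; have [/existsP[j /andP[]]|] :=
  boolP [exists j, (j \notin C) && ((j + 1)%R \in C)]; first by exists j.
rewrite negb_exists => /forallP clC; case/negP: CT; apply/eqP.
apply: shift_closed_setT => // j j1C.
by have := clC j; rewrite j1C andbT negbK.
Qed.

Lemma card_window j k : k <= r -> #|[set x : 'I_r | (x - j)%R < k]| = k.
Proof.
move=> le_kr.
rewrite (_ : [set x | _] =
           (fun u : 'I_r => (u + j)%R) @: [set u : 'I_r | u < k]).
  rewrite card_imset; last exact: addIr.
  rewrite -sum1_card (eq_bigl (fun u : 'I_r => u < k)); last first.
    by move=> u; rewrite inE.
  by rewrite (big_ord_narrow le_kr) sum_nat_const card_ord muln1.
apply/setP => x; rewrite inE; apply/idP/imsetP => [ltx | [u]].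
  by exists (x - j)%R; rewrite ?inE // subrK.
by rewrite inE => ltu ->; rewrite addrK.
Qed.

(* The cyclic window of length m starting at j is the set of the x with
   (x - j)%R < m. *)
Definition meets m A := [set j : 'I_r | [exists x in A, (x - j)%R < m]].

Lemma meetsP m A j :
  reflect (exists2 x, x \in A & (x - j)%R < m) (j \in meets m A).
Proof. by rewrite inE; apply: exists_inP. Qed.

Lemma meetsS m A j : j \in meets m A -> j \in meets m.+1 A.
Proof. by case/meetsP=> x xA ltm; apply/meetsP; exists x => //; apply: ltnW. Qed.

Lemma val_succ_le (u : 'I_r) : (u + 1)%R <= u.+1.
Proof. by rewrite /= modnDmr addn1 leq_mod. Qed.

(** The window of length m + 1 at [j] contains the window of length m at [j + 1]. *)
Lemma meetsS_succ m A j : (j + 1)%R \in meets m A -> j \in meets m.+1 A.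
Proof.
case/meetsP=> x xA ltm; apply/meetsP; exists x => //.
have -> : (x - j = x - (j + 1) + 1)%R by rewrite opprD addrA subrK.
by rewrite ltnS; apply: leq_trans (val_succ_le _) ltm.
Qed.

(** As long as the common set is not all of Z_r, it has a boundary, [j] outside and [j + 1] inside;
    one more unit of length captures [j]. *)
Lemma card_meets2_grow A B m d : meets m A :&: meets m B != set0 ->
  minn r (#|meets m A :&: meets m B| + d)
    <= #|meets (m + d) A :&: meets (m + d) B|.
Proof.
move=> J0; elim: d => [|d IHd]; first by rewrite !addn0 geq_minr.
set J := meets (m + d) A :&: meets (m + d) B in IHd.
rewrite !addnS; set J' := (X in _ <= #|X|).
have JJ' : J \subset J'.
  by apply/subsetP => j /setIP[jA jB]; rewrite inE !meetsS.
have [JT|JT] := eqVneq J setT.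
  rewrite geq_min; apply/orP; left.
  by move: JJ'; rewrite JT => /subset_leq_card; rewrite cardsT card_ord.
have Jn0 : J != set0.
  rewrite -card_gt0; apply: leq_trans IHd.
  by rewrite leq_min /= addn_gt0 card_gt0 J0.
have [j jJ] := shift_boundary Jn0 JT.
case/setIP => jA jB.
have jJ' : j \in J' by rewrite inE !meetsS_succ.
have : #|J| < #|J'| by apply: proper_card; apply/properP; split => //; exists j.
by lia.
Qed.

Lemma val_natr k : k < r -> (k%:R : 'I_r)%R = k :> nat.
Proof. by move=> lt_kr; rewrite Zp_nat /= modn_small. Qed.

Lemma val_subr_nat (u : 'I_r) k : k <= u -> (u - k%:R)%R = u - k :> nat.
Proof.
move=> le_ku; rewrite -[u in LHS]natr_Zp -[X in X%:R%R](subnK le_ku) natrD addrK.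
by rewrite val_natr //; apply: leq_ltn_trans (leq_subr _ _) (ltn_ord u).
Qed.

(** The window at [i] contains [i] but not [i - 1]. If u = i - j were nonzero, this would give both
    u < t and t <= u - 1. *)
Lemma window_inj t i j : 0 < t < r ->
  [set x : 'I_r | (x - i)%R < t] = [set x : 'I_r | (x - j)%R < t] -> i = j.
Proof.
case/andP=> t0 ltr eqW.
have iW : (i - j)%R < t by move/setP/(_ i): eqW; rewrite !inE subrr t0.
have pW : t <= (i - j - 1)%R.
  move/setP/(_ (i - 1)%R): eqW; rewrite !inE addrAC subrr sub0r addrAC.
  rewrite (_ : (-1 : 'I_r)%R < t = false); first by case: ltnP.
  by apply/negbTE; rewrite -leqNgt /= !modn_small.
apply/eqP; rewrite -subr_eq0; apply: contraTT iW => ij0; rewrite -leqNgt.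
apply: leq_trans pW _.
rewrite -[1%R]/(1%:R)%R val_subr_nat ?lt0n //.
exact: leq_subr.
Qed.

(* Writing t for the number of elements outside A and B, if no window of length
   t + 1 meets both A and B, then each boundary between windows meeting A and
   windows meeting B leaves a window of length t outside A and B. There are at
   least two boundaries and, unless t = 0, room for only one such window. *)
Lemma card_meets2 A B k : A != set0 -> B != set0 -> 1 < k <= r ->
  let t := #|~: (A :|: B)| in
  t < k -> k <= t + #|meets k A :&: meets k B|.
Proof.
move=> A0 B0 /andP[k1 kr] t ltk.
have ltr : t < r by apply: leq_trans ltk kr.
set C := meets t.+1 A; set D := meets t.+1 B.
have [J0|J0] := boolP (C :&: D == set0); last first.
  (* Growing from length t + 1 to k adds k - t - 1 starting points to at least one, unless all r are
     reached. *)
  have := card_meets2_grow (k - t.+1) J0; rewrite subnKC //.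
  move: J0; rewrite -card_gt0 -/C -/D; move: #|C :&: D| => a.
  by clearbody t; lia.
(* A window of length t + 1 does not fit into the t missing points, so it meets [A] or [B]. *)
have CD j : j \in D = (j \notin C).
  have [jC|jC] /= := boolP (j \in C).
    by apply/negP => jD; move/eqP/setP/(_ j): J0; rewrite in_setI jC jD in_set0.
  apply: contraT => jD; have : t.+1 <= t.
    rewrite -[X in X <= _](card_window j ltr).
    apply/subset_leq_card/subsetP => x; rewrite inE => xj; rewrite !inE negb_or.
    apply/andP; split; [apply: contra jC | apply: contra jD];
      by move=> xAB; apply/meetsP; exists x.
  by rewrite ltnn.
have meets0 E : E != set0 -> meets t.+1 E != set0.
  case/set0Pn=> x xE; apply/set0Pn; exists x; apply/meetsP; exists x => //.
  by rewrite subrr.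
have [|j jC j1C] := @shift_boundary C (meets0 _ A0).
  have /set0Pn[x] := meets0 _ B0; rewrite -/D CD.
  by apply: contraNneq => ->; rewrite inE.
have [|i iD i1D] := @shift_boundary D (meets0 _ B0).
  have /set0Pn[x] := meets0 _ A0; rewrite -/C => xC.
  by apply: contraTneq xC => DT; rewrite -CD DT inE.
have iC : i \in C by rewrite CD negbK in iD.
have neq_ij : i != j by apply: contraTneq iC => ->.
(* The window of length t at [l + 1] lies in the windows of length t + 1 at [l] and at [l + 1], so
   it avoids [E] and [F]; by cardinality it is the whole gap. *)
have gapW (E F : {set 'I_r}) l : l \notin meets t.+1 E ->
    (l + 1)%R \notin meets t.+1 F -> #|~: (E :|: F)| = t ->
  [set x : 'I_r | (x - (l + 1))%R < t] = ~: (E :|: F).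
  move=> lE lF cardT; apply/eqP; 
  rewrite eqEcard cardT card_window ?leqnn ?andbT; last exact: ltnW.
  apply/subsetP => x; rewrite inE => xl; rewrite !inE negb_or.
  apply/andP; split.
    apply: contra lE => xE; apply: (@meetsS_succ t).
    by apply/meetsP; exists x.
  by apply: contra lF => xF; apply/meetsP; exists x => //; apply: ltnW.
(* An empty gap cannot tell [i] and [j] apart; instead both start windows of length 2 meeting [A]
   and [B], and growth proceeds from these two. *)
have [t0|t0] := posnP t.
  have JJ : [set i; j] \subset meets 2 A :&: meets 2 B.
    rewrite -[2]/(1.+1) -t0; apply/subsetP => x; rewrite in_set2 in_setI.
    case/orP=> /eqP ->.
      by rewrite (meetsS iC) (meetsS_succ i1D).
    by rewrite (meetsS_succ j1C) meetsS // -/D CD.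
  have le2 : 2 <= #|meets 2 A :&: meets 2 B|.
    by apply: leq_trans (subset_leq_card JJ); rewrite cards2 neq_ij.
  have := @card_meets2_grow A B 2 (k - 2); rewrite subnKC // -card_gt0.
  move=> /(_ (ltnW le2)); rewrite t0 add0n; by move: #|_ :&: _| le2 => a; lia.
(* For t > 0 the windows at [i + 1] and [j + 1] are both the gap, hence i = j. *)
case/eqP: neq_ij; apply: (@addIr _ 1%R); apply: (@window_inj t).
  by rewrite t0.
rewrite (gapW B A) //; [|by rewrite CD in i1D|by rewrite setUC].
by rewrite (gapW A B) // 1?setUC // -/D CD negbK.
Qed.

Lemma kappa_circulant (Y : finType) (f : Y -> 'I_r) k :
  (forall j, exists y, f y = j) -> 1 < k <= r ->
  k <= kappa (bip (fun (x : 'I_r) y => (x - f y)%R < k)).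
Proof.
move=> f_surj k_range; have /andP[_ kr] := k_range.
apply: kappa_bip_ge => [|y|A B A0 B0 ltk].
- by have [y _] := f_surj 0%R; apply/card_gt0P; exists y.
- by rewrite card_window.
apply: leq_trans (card_meets2 A0 B0 k_range ltk) _; rewrite leq_add2l.
apply: leq_trans (leq_imset_card f _); apply/subset_leq_card/subsetP => j.
have [y <-] := f_surj j; rewrite !inE => yAB.
by apply: imset_f; rewrite inE.
Qed.

(** With u = x - j: the complement of the window of length k at j is the window of length r - k at j
    + k. *)
Lemma window_compl (u : 'I_r) k : k <= r ->
  ((u - k%:R)%R < r - k) = (k <= u).
Proof.
move=> le_kr; have ltu := ltn_ord u.
case: (leqP k u) => [le_ku|lt_uk]; first by rewrite val_subr_nat //; lia.
have -> : (u - k%:R = (u + (r - k))%:R)%R.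
  rewrite natrD natrB // natr_Zp; congr (_ + _)%R.
  by rewrite (pchar_Zp (isT : 1 < r)) sub0r.
by rewrite val_natr; lia.
Qed.

End CyclicWindows.

Theorem theorem3p3 (r s : nat) (le_rs : r <= s) :
  (forall (n : nat) (G : bigraph), #|G| = n -> #|partX G| = r -> #|partY G| = s ->
     0 <= kappa G + kappa (bip_compl G) <= r /\
     0 <= kappa G * kappa (bip_compl G) <= uphalf r * r./2)
  /\
  [/\ ~ (r = 1 /\ s = 1) ->
        exists G : bigraph, [/\ #|partX G| = r, #|partY G| = s &
          kappa G + kappa (bip_compl G) = 0],
      exists G : bigraph, [/\ #|partX G| = r, #|partY G| = s &
        kappa G + kappa (bip_compl G) = r],
      exists G : bigraph, [/\ #|partX G| = r, #|partY G| = s &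
        kappa G * kappa (bip_compl G) = 0] &
      r <> 2 -> r <> 3 ->
        exists G : bigraph, [/\ #|partX G| = r, #|partY G| = s &
          kappa G * kappa (bip_compl G) = uphalf r * r./2]].
Proof.
have ub (G : bigraph) : #|partX G| = r -> #|partY G| = s ->
    kappa G + kappa (bip_compl G) <= r.
  by move=> GX GY; rewrite -GX; apply: kappa_add_compl_le; rewrite GX GY.
pose emp := bip (fun (_ : 'I_r) (_ : 'I_s) => false).
have empX : #|partX emp| = r by rewrite card_bipX card_ord.
have empY : #|partY emp| = s by rewrite card_bipY card_ord.
have k_void (G : bigraph) : #|partX G| = r -> #|partY G| = s -> s = 0 -> kappa G = 0.
  move=> GX GY s0; apply/kappa_void/eqP; rewrite -cardsT -partU -leqn0.
  by rewrite (leq_trans (leq_card_setU _ _)) // GX GY; lia.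
have k_emp : kappa emp = 0.
  have [s0|s_gt0] := posnP s; first exact: k_void.
  exact: (kappa_bip_isolated (y := Ordinal s_gt0)).
split=> [n G _ GX GY|].
  by rewrite !leq0n; split; [|apply: leq_mul_halves]; apply: ub.
split.
(* Vertex 0 of Y is joined to all of X, the others to none. So 0 is isolated in the complement and
   the last vertex in the graph; if they coincide, s = 1, hence r = 0 and X is empty. *)
- move=> rs1; pose e (_ : 'I_r) (y : 'I_s) := val y == 0.
  have eX : #|partX (bip e)| = r by rewrite card_bipX card_ord.
  have eY : #|partY (bip e)| = s by rewrite card_bipY card_ord.
  exists (bip e); split=> //.
  have [s0|s_gt0] := posnP s; first by rewrite !k_void.
  have lt_last : s.-1 < s by rewrite prednK.
  rewrite kappa_bip_compl (kappa_bip_isolated (y := Ordinal lt_last)).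
    by rewrite (kappa_bip_isolated (y := Ordinal s_gt0)).
  by move=> x; have := ltn_ord x; rewrite /e /=; lia.
- exists emp; split=> //; apply/eqP; rewrite eqn_leq ub //= k_emp add0n.
  have [s0|s_gt0] := posnP s; first by apply: (@leq_trans 0); rewrite // -s0.
  rewrite kappa_bip_compl -[X in X <= _]card_ord.
  by apply: kappa_bip_complete; rewrite ?card_ord.
- by exists emp; rewrite k_emp.
(* For r <= 1 the product bound is 0, attained by the edgeless graph. *)
move=> r_neq2 r_neq3; have [r_le1|r_gt1] := leqP r 1.
  by exists emp; split=> //; rewrite k_emp mul0n; move: r_le1; case: (r) => [|[]].
(* From r = 4 on, both halves are at least 2, as [kappa_circulant] requires. *)
have [n rE] : exists n, r = n.+4 by exists (r - 4); lia.
move: le_rs ub; rewrite rE; clear => le_rs ub.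
set r' := n.+4 in le_rs ub *; set k := uphalf r'.
pose f (y : 'I_s) : 'I_r' := inZp y.
have f_surj j : exists y, f y = j.
  by exists (widen_ord le_rs j); rewrite /f /= valZpK.
have half_r : r'./2 = r' - k.
  by rewrite /k; have := uphalf_half r'; have := odd_double_half r'; lia.
have [k_range k'_range] : 1 < k <= r' /\ 1 < r' - k <= r'.
  rewrite -half_r /k /r' /=.
  by have := odd_double_half n; have := uphalf_half n; lia.
have /andP[_ le_kr] := k_range.
pose e (x : 'I_r') y := (x - f y)%R < k.
have eX : #|partX (bip e)| = r' by rewrite card_bipX card_ord.
have eY : #|partY (bip e)| = s by rewrite card_bipY card_ord.
exists (bip e); split=> //.
have ge1 : k <= kappa (bip e) by apply: kappa_circulant.
have ge2 : r' - k <= kappa (bip_compl (bip e)).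
  rewrite kappa_bip_compl.
  rewrite (@eq_kappa_bip _ _ _ (fun (x : 'I_r') y => (x - (f y + k%:R))%R < r' - k)).
    apply: kappa_circulant => // j; have [y fy] := f_surj (j - k%:R)%R.
    by exists y; rewrite fy subrK.
  by move=> x y; rewrite opprD addrA window_compl // -leqNgt.
(* The lower bounds k and r' - k already add up to the upper bound r', so both are equalities. *)
have := ub _ eX eY; rewrite half_r => le_sum; congr (_ * _); lia.
Qed.
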